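(* For every positive integer $s$, there exists a positive integer $s'$ such that every $3$-uniform linear hypergraph $G$ which contains a matching of size $s'$ contains an induced matching of size $s$.
   Context: A hypergraph $G=(V,E)$ consists of a finite vertex set $V=V(G)$ and an edge set $E=E(G)\subseteq 2^{V}\setminus\{\emptyset\}$. It is $3$-uniform if $|e|=3$ for all $e\in E$, and linear if $|e\cap e'|\le 1$ for every two distinct $e,e'\in E(G)$. A matching of size $m$ in $G$ is a set of $m$ pairwise disjoint edges of $G$. An induced matching of size $m$ in $G$ is a matching $M\subseteq E(G)$ with $|M|=m$ such that the only edges of $G$ contained in $\bigcup_{e\in M}e$ are the edges of $M$. *)

(* Defs.v *)
From mathcomp Require Import all_boot.

Set Implicit Arguments.
Unset Strict Implicit.
Unset Printing Implicit Defensive.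

Record hypergraph (V : finType) := Hypergraph {
  edges : {set {set V}};
  edges_nonempty : set0 \notin edges
}.

Definition uniform (k : nat) (V : finType) (G : hypergraph V) : Prop :=
  forall e : {set V}, e \in edges G -> #|e| = k.

Definition linear_hypergraph (V : finType) (G : hypergraph V) : Prop :=
  forall e f : {set V},
    e \in edges G -> f \in edges G -> e != f -> #|e :&: f| <= 1.

Definition is_matching (V : finType) (G : hypergraph V) (M : {set {set V}}) : Prop :=
  M \subset edges G /\
  (forall e f : {set V}, e \in M -> f \in M -> e != f -> [disjoint e & f]).

Definition is_induced_matching (V : finType) (G : hypergraph V)
    (M : {set {set V}}) : Prop :=
  is_matching G M /\
  (forall e : {set V}, e \in edges G -> e \subset cover M -> e \in M).

(* Main.v *)
Require Import Defs.
From mathcomp Require Import all_boot.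

Set Implicit Arguments.
Unset Strict Implicit.
Unset Printing Implicit Defensive.

(** The induced matching is built greedily inside the given matching [M].
    Let [N] be an induced matching contained in [M], and let [U] be the set of
    vertices it covers.  Adding an edge [A] of [M :\: N] destroys inducedness
    only if some edge [e], other than [A], lies in [U :|: A] and meets [A].  By
    linearity [e] has at most one vertex in [A], hence at least two in [U].
    Say that an edge blocks [A] if it meets [A] and has at least two vertices
    in [U].  A blocking edge is determined by its trace [e :&: U], because two
    vertices lie in at most one common edge, and it blocks at most one member
    of [M :\: N], because these are disjoint from [U] and [e] has at most one
    vertex outside [U].  So at most [2 ^ #|U|] members of [M :\: N] are blocked
    ([exists_unblocked]), and any unblocked one can be added to [N]
    ([induced_matching_extend]).  Since [#|U| <= 3 * #|N|], a matching of size
    [s + 2 ^ (3 * s)] has an unblocked edge left as long as [#|N| < s]. *)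

Section LinearTripleSystem.

Variables (V : finType) (G : hypergraph V).
Hypotheses (G3 : uniform 3 G) (Glin : linear_hypergraph G).

Definition blocks (U A e : {set V}) : bool :=
  [&& e \in edges G, 1 < #|e :&: U| & ~~ [disjoint e & A]].

Lemma eq_edge_of_trace (U e f : {set V}) :
  e \in edges G -> f \in edges G -> 1 < #|e :&: U| -> e :&: U = f :&: U ->
  e = f.
Proof.
move=> eG fG two_e eqU; apply/eqP/negPn/negP=> neq_ef.
have := Glin eG fG neq_ef; rewrite leqNgt => /negP; apply.
apply: leq_trans two_e (subset_leq_card _).
by rewrite subsetI subsetIl eqU subsetIl.
Qed.

(** The only vertex of [e] outside [U] would have to lie in both sets. *)
Lemma blocks_inj (U A B e : {set V}) :
  [disjoint A & U] -> [disjoint B & U] -> blocks U A e -> blocks U B e ->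
  ~~ [disjoint A & B].
Proof.
move=> dAU dBU /and3P[eG two_e /pred0Pn[x /andP[/= xe xA]]].
case/and3P=> _ _ /pred0Pn[y /andP[/= ye yB]].
have one_out : #|e :\: U| <= 1.
  by rewrite cardsD (G3 eG) leq_subLR addn1.
have xy : x = y.
  apply: (card_le1_eqP one_out).
    by rewrite inE ye (disjointFr dBU yB).
  by rewrite inE xe (disjointFr dAU xA).
by apply/pred0Pn; exists x; rewrite /= xA xy.
Qed.

(** Pigeonhole on the traces on [U] of blocking edges. *)
Lemma exists_unblocked (U : {set V}) (L : {set {set V}}) :
  {in L &, forall A B : {set V}, A != B -> [disjoint A & B]} ->
  {in L, forall A : {set V}, [disjoint A & U]} ->
  2 ^ #|U| < #|L| ->
  exists2 A, A \in L & forall e, ~~ blocks U A e.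
Proof.
move=> dL dLU ltL.
have [/existsP[A /andP[AL /forallP nA]] | noA] :=
    boolP [exists A in L, [forall e, ~~ blocks U A e]]; first by exists A.
pose blocker A := odflt set0 [pick e | blocks U A e].
have blockerP A : A \in L -> blocks U A (blocker A).
  move=> AL; rewrite /blocker; case: pickP => //= none.
  case/negP: noA; apply/existsP; exists A; rewrite AL /=.
  by apply/forallP=> e; rewrite none.
suff: #|L| <= 2 ^ #|U| by rewrite leqNgt ltL.
pose trace A := blocker A :&: U.
have trace_inj : {in L &, injective trace}.
  move=> A B AL BL eqAB; have bA := blockerP A AL; have bB := blockerP B BL.
  have eq_blocker : blocker A = blocker B.
    case/and3P: (bA) => eG two_e _; case/and3P: (bB) => fG _ _.
    exact: eq_edge_of_trace eG fG two_e eqAB.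
  rewrite -eq_blocker in bB.
  apply/eqP/negPn/negP=> /(dL _ _ AL BL) dAB.
  by have := blocks_inj (dLU A AL) (dLU B BL) bA bB; rewrite dAB.
rewrite -(card_in_imset trace_inj) -card_powerset subset_leq_card //.
by apply/subsetP=> _ /imsetP[A _ ->]; rewrite inE subsetIr.
Qed.

Lemma induced_matching_extend (M N : {set {set V}}) (A : {set V}) :
  is_matching G M -> N \subset M -> is_induced_matching G N ->
  A \in M -> (forall e, ~~ blocks (cover N) A e) ->
  is_induced_matching G (A |: N).
Proof.
move=> [sMG dM] sNM [_ indN] AM nblocked.
have sANM : A |: N \subset M by rewrite subUset sub1set AM.
split; first split.
- exact: subset_trans sANM sMG.
- by move=> e f /(subsetP sANM) eM /(subsetP sANM) fM; apply: dM.
move=> e eG; rewrite /cover bigcup_setU big_set1 -/(cover N) => sub_e.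
rewrite !inE; have [//|neA /=] := eqVneq e A.
have one_A : #|e :&: A| <= 1 by apply: Glin eG (subsetP sMG _ AM) neA.
have [dis|meet] := boolP [disjoint e & A].
  apply: indN eG _; apply/subsetP=> x xe.
  by have := subsetP sub_e x xe; rewrite inE (disjointFr dis xe).
(* At most one of the three vertices of [e] is in [A]: the others are covered
   by [N], so [e] blocks [A]. *)
case/negP: (nblocked e); rewrite /blocks eG meet andbT /=.
have : #|e| <= #|e :&: A| + #|e :&: cover N|.
  rewrite -{1}(setIidPl sub_e) setIUr.
  by rewrite cardsU leq_subr.
rewrite (G3 eG) => le3.
by rewrite -(leq_add2l 1); apply: leq_trans le3 _; rewrite leq_add2r.
Qed.

Lemma card_cover_uniform (N : {set {set V}}) :
  N \subset edges G -> #|cover N| <= 3 * #|N|.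
Proof.
move=> sNG; apply: leq_trans (leq_card_cover N) _.
rewrite mulnC -sum_nat_const; apply: leq_sum => A AN.
by rewrite (G3 (subsetP sNG _ AN)).
Qed.

Lemma induced_submatching (M : {set {set V}}) (s : nat) :
  is_matching G M -> s + 2 ^ (3 * s) <= #|M| ->
  exists N : {set {set V}},
    [/\ N \subset M, is_induced_matching G N & #|N| = s].
Proof.
move=> matM leM; have [sMG dM] := matM.
suff: forall k, k <= s -> exists N : {set {set V}},
    [/\ N \subset M, is_induced_matching G N & #|N| = k] by apply.
elim=> [_|k IHk lt_ks].
  exists set0; split; rewrite ?sub0set ?cards0 //.
  split; first by split=> [|e f]; rewrite ?sub0set ?inE.
  move=> e eG; rewrite /cover big_set0 subset0 => /eqP e0.
  by have := edges_nonempty G; rewrite -e0 eG.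
have [N [sNM indN cardN]] := IHk (ltnW lt_ks).
have dL : {in M :\: N &, forall A B : {set V}, A != B -> [disjoint A & B]}.
  by move=> A B /setDP[AM _] /setDP[BM _]; apply: dM.
have dLU : {in M :\: N, forall A : {set V}, [disjoint A & cover N]}.
  move=> A /setDP[AM AN]; apply/bigcup_disjointP => B BN.
  apply: dM AM (subsetP sNM _ BN) _.
  by apply: contraNneq AN => ->.
have ltL : 2 ^ #|cover N| < #|M :\: N|.
  have le_pow : 2 ^ #|cover N| <= 2 ^ (3 * s).
    rewrite leq_exp2l //; apply: leq_trans (card_cover_uniform _) _.
      exact: subset_trans sNM sMG.
    by rewrite cardN leq_mul2l ltnW ?orbT.
  rewrite cardsD (setIidPr sNM) cardN ltn_subRL.
  apply: leq_trans leM; rewrite -addSn.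
  exact: leq_add.
have [A /setDP[AM AN] nblocked] := exists_unblocked dL dLU ltL.
exists (A |: N); split.
- by rewrite subUset sub1set AM.
- exact: induced_matching_extend matM sNM indN AM nblocked.
- by rewrite cardsU1 AN cardN.
Qed.

End LinearTripleSystem.

Theorem lemma7p2 :
  forall s : nat, 0 < s ->
  exists s' : nat, 0 < s' /\
    forall (V : finType) (G : hypergraph V),
      uniform 3 G -> linear_hypergraph G ->
      (exists M : {set {set V}}, is_matching G M /\ #|M| = s') ->
      exists M : {set {set V}}, is_induced_matching G M /\ #|M| = s.
Proof.
move=> s s_gt0; exists (s + 2 ^ (3 * s)); split; first by rewrite addn_gt0 s_gt0.
move=> V G G3 Glin [M [matM cardM]].
have leM : s + 2 ^ (3 * s) <= #|M| by rewrite cardM.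
by have [N [_ indN cardN]] := induced_submatching G3 Glin matM leM; exists N.
Qed.
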